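(* Let $k$ be a positive integer. There is an algorithm that, given a graph $G$ on $n$ vertices with $\Delta_G\le k\cdot(\log_2 n)^{1/2}$ and an edge $xy\in E(G)$, decides whether $xy$ is relating in $O(n^{2+2k^2})$ time.
   Context: All graphs are finite, simple, undirected; $n=|V(G)|$ and $\Delta_G=\max\{|N(v)|:v\in V(G)\}$. An independent set is maximal if it is not properly contained in another independent set. An edge $xy$ of $G$ is relating if there exists an independent set $S$ of $G$ such that both $S\cup\{x\}$ and $S\cup\{y\}$ are maximal independent sets of $G$. *)

(* Defs.v *)
From mathcomp Require Import all_boot all_order all_algebra.
From mathcomp Require Import reals exp.

Set Implicit Arguments.
Unset Strict Implicit.
Unset Printing Implicit Defensive.

Record sgraph (T : finType) := SGraph {
  adj :> rel T;
  adj_sym : symmetric adj;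
  adj_irr : irreflexive adj }.

Section Graphs.
Variables (T : finType) (G : sgraph T).

Definition neighbours (v : T) : {set T} := [set u | G v u].

Definition max_degree : nat := \max_(v : T) #|neighbours v|.

Definition independent (S : {set T}) : bool :=
  [forall u in S, forall v in S, ~~ G u v].

Definition maximal_independent (S : {set T}) : bool := maxset independent S.

Definition relating (x y : T) : Prop :=
  exists S : {set T},
    [/\ independent S, maximal_independent (x |: S)
      & maximal_independent (y |: S)].

End Graphs.

Definition log2 (R : realType) (x : R) : R := (ln x / ln 2)%R.

Definition bigO (f g : nat -> nat) : Prop :=
  exists C N : nat, forall n, N <= n -> f n <= C * g n.

(* Algorithms are programs of a unit-cost word RAM: a register file, a memory
   addressed by register contents, and structured control flow.  Every
   instruction and every test costs one step. *)

Inductive binop := OAdd | OSub | OMul | ODiv | OMod.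

Definition eval_op (o : binop) : nat -> nat -> nat :=
  match o with
  | OAdd => addn | OSub => subn | OMul => muln | ODiv => divn | OMod => modn
  end.

Inductive instr :=
  | IConst (d c : nat)                (* r_d := c          *)
  | IOp (o : binop) (d a b : nat)     (* r_d := r_a o r_b  *)
  | ILoad (d a : nat)                 (* r_d := ram[r_a]   *)
  | IStore (a b : nat).               (* ram[r_a] := r_b   *)

Inductive prog :=
  | Skip
  | Do (i : instr)
  | Seq (p q : prog)
  | If (r : nat) (p q : prog)         (* the test is r_r <> 0 *)
  | While (r : nat) (p : prog).

Record state := State { reg : nat -> nat; ram : nat -> nat }.

Definition upd (f : nat -> nat) (a v : nat) : nat -> nat :=
  fun b => if b == a then v else f b.

(* Words have w bits: an instruction whose result is not below 2 ^ w faults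
   (None), and a faulting run never terminates in the sense of [exec].  Hence
   unit cost cannot be abused by computing with huge numbers. *)
Definition set_reg (w : nat) (s : state) (d v : nat) : option state :=
  if v < 2 ^ w then Some (State (upd (reg s) d v) (ram s)) else None.

Definition exec_instr (w : nat) (i : instr) (s : state) : option state :=
  match i with
  | IConst d c => set_reg w s d c
  | IOp o d a b => set_reg w s d (eval_op o (reg s a) (reg s b))
  | ILoad d a => set_reg w s d (ram s (reg s a))
  | IStore a b => Some (State (reg s) (upd (ram s) (reg s a) (reg s b)))
  end.

(* [exec w p s t s']: from state s, p halts in state s' after t steps. *)
Inductive exec (w : nat) : prog -> state -> nat -> state -> Prop :=
  | ExecSkip s : exec w Skip s 0 s
  | ExecDo i s s' : exec_instr w i s = Some s' -> exec w (Do i) s 1 s'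
  | ExecSeq p q s s1 s2 t1 t2 :
      exec w p s t1 s1 -> exec w q s1 t2 s2 -> exec w (Seq p q) s (t1 + t2) s2
  | ExecIfT r p q s s' t :
      reg s r != 0 -> exec w p s t s' -> exec w (If r p q) s t.+1 s'
  | ExecIfF r p q s s' t :
      reg s r = 0 -> exec w q s t s' -> exec w (If r p q) s t.+1 s'
  | ExecWhileT r p s s1 s2 t1 t2 :
      reg s r != 0 -> exec w p s t1 s1 -> exec w (While r p) s1 t2 s2 ->
      exec w (While r p) s (t1 + t2).+1 s2
  | ExecWhileF r p s : reg s r = 0 -> exec w (While r p) s 1 s.

(* The run is unique, so asserting that some run has a property says that the
   run of the program has it. *)
Lemma exec_det w p s t1 s1 t2 s2 :
  exec w p s t1 s1 -> exec w p s t2 s2 -> t1 = t2 /\ s1 = s2.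
Proof.
move=> E; elim: E t2 s2 => {p s t1 s1}.
- by move=> s t s2 E; inversion E.
- by move=> i s s' H t s2 E; inversion E; subst; split=> //; congruence.
- move=> p q s s1 s2 t1 t2 _ IH1 _ IH2 t s3 E.
  inversion E as [| |? ? ? ? ? ? ? F1 F2| | | |]; subst.
  by case: (IH1 _ _ F1) => ? ?; subst; case: (IH2 _ _ F2) => ? ?; subst.
- move=> r p q s s' t /eqP nz _ IH t2 s2 E.
  inversion E as [| | |? ? ? ? ? ? _ F|? ? ? ? ? ? z _| |]; subst=> //.
  by case: (IH _ _ F) => ? ?; subst.
- move=> r p q s s' t z _ IH t2 s2 E.
  inversion E as [| | |? ? ? ? ? ? nz _|? ? ? ? ? ? _ F| |]; subst.
    by rewrite z in nz.
  by case: (IH _ _ F) => ? ?; subst.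
- move=> r p s s1 s2 t1 t2 /eqP nz _ IH1 _ IH2 t s3 E.
  inversion E as [| | | | |? ? ? ? ? ? ? _ F1 F2|? ? ? z]; subst=> //.
  by case: (IH1 _ _ F1) => ? ?; subst; case: (IH2 _ _ F2) => ? ?; subst.
- move=> r p s z t s2 E.
  inversion E as [| | | | |? ? ? ? ? ? ? nz _ _|]; subst=> //.
  by rewrite z in nz.
Qed.

(* Registers 0, 1, 2 hold n, x, y; memory holds the adjacency matrix of G in
   row-major order from address 0; everything else is 0. *)
Definition input (n : nat) (G : sgraph 'I_n) (x y : 'I_n) : state :=
  State
    (fun r => match r with
              | 0 => n | 1 => nat_of_ord x | 2 => nat_of_ord y | _ => 0 end)
    (fun a => [exists u : 'I_n, exists v : 'I_n, (a == n * u + v) && G u v]).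

Definition accepts (s : state) : Prop := reg s 0 != 0.

(* [a * up_log 2 n.+1] is a word size of O(log n) bits, and an input with n
   vertices fits in such words as soon as a > 0. *)
Definition runs (a : nat) (p : prog) (n : nat) (G : sgraph 'I_n)
    (x y : 'I_n) (t : nat) (s : state) : Prop :=
  exec (a * up_log 2 n.+1) p (input G x y) t s.

(* Main.v *)
Require Import Defs.
From mathcomp Require Import all_boot all_order all_algebra.
From mathcomp Require Import reals exp.
From mathcomp Require Import zify.

Import Order.TTheory GRing.Theory Num.Theory.

(** Call a vertex split if it differs from [x] and [y] and is adjacent to exactly
one of them, and call a neighbour of a split vertex a candidate if it is
adjacent to neither [x] nor [y].  The edge [xy] is relating iff some independent
set of candidates dominates the split vertices.  There are at most [2 D] split
vertices, hence at most [2 D^2] candidates, where [D] is the maximum degree; as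
[D^2 <= k^2 log2 n], all sets of candidates are enumerated by the masks
[M < n^(2 k^2)], and each of them is tested in [O(n^2)] steps. *)

(** A budget of [O(n^2)] per mask leaves constant time to decide whether a mask selects a vertex.
    The divisors that extract the bits are therefore tabulated once: recomputing one costs [O(n^2)],
    while the whole table costs [O(n^3)], which [n^(2 + 2 k^2)] absorbs. The program knows neither
    [D] nor the number of candidates and tries every [M < n^(2 k^2)]; this is sound because any
    number decodes to a set of candidates. The same bound lets a mask fit in a word of [O(log n)]
    bits. Searches are expressions without early exit, so a cost bound is read off their shape and
    loop bounds. *)

(** * Rules for total correctness with a bound on the number of steps *)

Section Runs.
Variable w : nat.

Definition runs_to (p : prog) (s : state) (c : nat) (Q : state -> Prop) : Prop :=
  exists t s', [/\ exec w p s t s', t <= c & Q s'].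

Lemma runs_to_weaken p s c c' (Q Q' : state -> Prop) :
  c <= c' -> (forall s', Q s' -> Q' s') -> runs_to p s c Q -> runs_to p s c' Q'.
Proof.
move=> lecc' QQ' [t [s' [E let' Qs']]]; exists t, s'; split=> //.
  exact: leq_trans lecc'.
exact: QQ'.
Qed.

Lemma runs_to_do i s s' (Q : state -> Prop) :
  exec_instr w i s = Some s' -> Q s' -> runs_to (Do i) s 1 Q.
Proof. by move=> E Qs'; exists 1, s'; split=> //; constructor. Qed.

Lemma runs_to_const d v s (Q : state -> Prop) :
  v < 2 ^ w -> Q (State (upd (reg s) d v) (ram s)) -> runs_to (Do (IConst d v)) s 1 Q.
Proof. by move=> lev; apply: runs_to_do; rewrite /= /set_reg lev. Qed.

Lemma runs_to_op o d a b s (Q : state -> Prop) :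
  eval_op o (reg s a) (reg s b) < 2 ^ w ->
  Q (State (upd (reg s) d (eval_op o (reg s a) (reg s b))) (ram s)) ->
  runs_to (Do (IOp o d a b)) s 1 Q.
Proof. by move=> lev; apply: runs_to_do; rewrite /= /set_reg lev. Qed.

Lemma runs_to_load d a s (Q : state -> Prop) :
  ram s (reg s a) < 2 ^ w ->
  Q (State (upd (reg s) d (ram s (reg s a))) (ram s)) ->
  runs_to (Do (ILoad d a)) s 1 Q.
Proof. by move=> lev; apply: runs_to_do; rewrite /= /set_reg lev. Qed.

Lemma runs_to_seq p q s c1 c2 Q :
  runs_to p s c1 (fun s1 => runs_to q s1 c2 Q) -> runs_to (Seq p q) s (c1 + c2) Q.
Proof.
case=> t1 [s1 [E1 le1 [t2 [s2 [E2 le2 Qs2]]]]].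
by exists (t1 + t2), s2; split; [exact: ExecSeq E1 E2 | exact: leq_add|].
Qed.

(** The test register [t] holds [b - i]. It is recomputed after the body, so the body may overwrite
    it. *)
Definition for_loop (i b t : nat) (body : prog) : prog :=
  Seq (Do (IConst i 0)) (Seq (Do (IOp OSub t b i))
   (While t (Seq body (Seq (Do (IConst t 1))
     (Seq (Do (IOp OAdd i i t)) (Do (IOp OSub t b i))))))).

(** The stability hypothesis makes the invariant blind to [i] and [t], which the loop itself
    changes. A round adds 4 steps to the body, for the test and three instructions; the last 3 are
    two initialisations and the failing test. *)
Lemma runs_to_for i b t body N c (I : nat -> state -> Prop) s :
  uniq [:: i; b; t] -> 1 < 2 ^ w -> N < 2 ^ w ->
  (forall j s s', (forall r, r != i -> r != t -> reg s' r = reg s r) ->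
     ram s' = ram s -> I j s -> I j s') ->
  (forall j s, j < N -> reg s i = j -> reg s b = N -> I j s ->
     runs_to body s c (fun s' => [/\ reg s' i = j, reg s' b = N & I j.+1 s'])) ->
  reg s b = N -> I 0 s ->
  runs_to (for_loop i b t body) s (N * (c + 4) + 3) (I N).
Proof.
rewrite /= !inE => /and3P[/norP[ib it] bt _] w1 wN stab step sb I0.
have [bi ti tb] : [/\ b != i, t != i & t != b] by rewrite ![b == _]eq_sym ![t == _]eq_sym.
have loop k j s1 : k + j = N -> reg s1 i = j -> reg s1 b = N -> reg s1 t = k ->
    I j s1 ->
    runs_to (While t (Seq body (Seq (Do (IConst t 1))
      (Seq (Do (IOp OAdd i i t)) (Do (IOp OSub t b i)))))) s1 (k * (c + 4) + 1) (I N).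
  elim: k j s1 => [|k IH] j s1.
    rewrite add0n => <- _ _ s1t Ij; exists 1, s1; split=> //; exact: ExecWhileF.
  move=> kj s1i s1b s1t Ij.
  have jN : j < N by lia.
  have : runs_to (Seq body (Seq (Do (IConst t 1))
      (Seq (Do (IOp OAdd i i t)) (Do (IOp OSub t b i))))) s1 (c + (1 + (1 + 1)))
      (fun s2 => [/\ reg s2 i = j.+1, reg s2 b = N, reg s2 t = k & I j.+1 s2]).
    apply: runs_to_seq; apply: runs_to_weaken (step j s1 jN s1i s1b Ij) => //.
    move=> s2 [s2i s2b I2].
    apply: runs_to_seq; apply: runs_to_const => //.
    apply: runs_to_seq; apply: runs_to_op => /=.
      rewrite /upd eqxx (negPf it) s2i; lia.
    apply: runs_to_op => /=.
      by rewrite /upd (negPf bt) eqxx (negPf bi) s2b; lia.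
    rewrite /upd !eqxx (negPf it) (negPf bi) (negPf bt) s2i s2b addn1.
    split=> //; first by lia.
    apply: stab I2 => //= r /negPf -> /negPf -> //.
  case=> t1 [s2 [E1 le1 [s2i s2b s2t I2]]].
  have [|t2 [s3 [E2 le2 I3]]] := IH j.+1 s2 _ s2i s2b s2t I2; first by lia.
  exists (t1 + t2).+1, s3; split=> //; last by lia.
  by apply: ExecWhileT E1 E2; rewrite s1t.
rewrite (_ : N * (c + 4) + 3 = 1 + (1 + (N * (c + 4) + 1))); last by lia.
apply: runs_to_seq; apply: runs_to_const; first by lia.
apply: runs_to_seq; apply: runs_to_op => /=.
  by rewrite /upd eqxx (negPf bi) sb subn0.
apply: (loop N 0) => //=; rewrite /upd ?eqxx ?(negPf it) ?(negPf bt) ?(negPf bi) ?sb ?subn0 ?addn0 //.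
apply: stab I0 => //= r /negPf -> /negPf -> //.
Qed.

End Runs.

(** * Expressions evaluated on a stack of registers *)

(* Registers below [nvars] hold program variables, those above are a stack of
   temporaries: a [code] at height [d] leaves its value in register [d] and
   overwrites only variables that are not in scope and registers above [d]. *)
Definition nvars : nat := 8.

Definition code : Type := nat -> prog.

Definition const (c : nat) : code := fun d => Do (IConst d c).
Definition var (r : nat) : code :=
  fun d => Seq (Do (IConst d 0)) (Do (IOp OAdd d d r)).
Definition op (o : binop) (e1 e2 : code) : code :=
  fun d => Seq (e1 d) (Seq (e2 d.+1) (Do (IOp o d d d.+1))).
Definition load (e : code) : code := fun d => Seq (e d) (Do (ILoad d d)).
(** Register [d] keeps the bound and [d.+1] the accumulator; [d.+2] is both the test register and
    the place where the body leaves its value. *)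
Definition fold (o : binop) (c0 i : nat) (bound body : code) : code :=
  fun d => Seq (bound d) (Seq (Do (IConst d.+1 c0))
    (Seq (for_loop i d d.+2 (Seq (body d.+2) (Do (IOp o d.+1 d.+1 d.+2))))
      (Seq (Do (IConst d 0)) (Do (IOp OAdd d d d.+1))))).

Section Computes.
Variable w : nat.
Hypothesis w_gt2 : 2 < 2 ^ w.

Definition live (V : seq nat) (d : nat) := [pred r | (r \in V) || (nvars <= r < d)].

(** The environment [f] is constrained on [V] only, so an expression may use other variables as loop
    counters. Preserving the live registers protects pending operands and enclosing loops. *)
Definition computes (V : seq nat) (f m : nat -> nat) (e : code) (v c : nat) : Prop :=
  forall d s, nvars <= d -> {in V, reg s =1 f} -> ram s =1 m ->
  runs_to w (e d) s c (fun s' =>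
    [/\ reg s' d = v, {in live V d, reg s' =1 reg s} & ram s' = ram s]).

Variable m : nat -> nat.
Implicit Types (V : seq nat) (f : nat -> nat) (e : code).

Definition scope V : bool := all (fun r => r < nvars) V.

Lemma live_neq V d d' r :
  scope V -> nvars <= d -> d <= d' -> r \in live V d -> r == d' = false.
Proof.
move=> /allP sV ld ldd' /orP[/sV rV|/andP[_ rd]]; apply/eqP; lia.
Qed.

Lemma liveV V d r : r \in V -> r \in live V d.
Proof. by rewrite inE => ->. Qed.

Lemma live_top V d d' : nvars <= d -> d < d' -> d \in live V d'.
Proof. by rewrite inE => -> ->; rewrite orbT. Qed.

Lemma live_leq V V' d d' r :
  {subset V <= V'} -> d <= d' -> r \in live V d -> r \in live V' d'.
Proof.
move=> VV' dd'; rewrite !inE => /orP[/VV' -> //|/andP[-> rd]].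
by rewrite (leq_trans rd dd') orbT.
Qed.

Lemma computes_le V f e v c c' : c <= c' -> computes V f m e v c -> computes V f m e v c'.
Proof. by move=> cc' H d s ld Vf sm; apply: runs_to_weaken (H d s ld Vf sm). Qed.

Lemma computes_const V f c : scope V -> c < 2 ^ w -> computes V f m (const c) c 1.
Proof.
move=> sV cw d s ld Vf sm; apply: runs_to_const => //; split=> //=.
  by rewrite /upd eqxx.
by move=> r hr; rewrite /upd (live_neq _ _ _ _ sV ld (leqnn d) hr).
Qed.

Lemma computes_var V f r : scope V -> r \in V -> f r < 2 ^ w ->
  computes V f m (var r) (f r) 2.
Proof.
move=> sV rV rw d s ld Vf sm.
have rd := live_neq _ _ _ _ sV ld (leqnn d) (liveV _ _ _ rV).
rewrite -[2]/(1 + 1); apply: runs_to_seq; apply: runs_to_const => /=; first by lia.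
apply: runs_to_op => /=; rewrite /upd eqxx rd add0n (Vf _ rV) //.
split=> //= r' hr; first by rewrite (live_neq _ _ _ _ sV ld (leqnn d) hr).
Qed.

Lemma computes_op V f o e1 e2 v1 v2 c1 c2 : scope V ->
  computes V f m e1 v1 c1 -> computes V f m e2 v2 c2 -> eval_op o v1 v2 < 2 ^ w ->
  computes V f m (op o e1 e2) (eval_op o v1 v2) (c1 + c2 + 1).
Proof.
move=> sV H1 H2 vw d s ld Vf sm; rewrite -addnA; apply: runs_to_seq.
apply: runs_to_weaken (H1 d s ld Vf sm) => // s1 [s1d s1r s1m].
apply: runs_to_seq; apply: runs_to_weaken (H2 d.+1 s1 _ _ _) => //; first last.
- by rewrite s1m.
- by move=> r rV; rewrite s1r ?liveV ?Vf.
- exact: leq_trans ld _.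
move=> s2 [s2d s2r s2m].
have s2d' : reg s2 d = v1 by rewrite s2r ?live_top.
apply: runs_to_op; rewrite s2d' s2d //; split=> /=; [by rewrite /upd eqxx | | by rewrite s2m].
move=> r hr; rewrite /upd (live_neq _ _ _ _ sV ld (leqnn d) hr) s2r ?s1r //.
exact: live_leq hr.
Qed.

Lemma computes_load V f e v c : scope V ->
  computes V f m e v c -> m v < 2 ^ w -> computes V f m (load e) (m v) (c + 1).
Proof.
move=> sV H vw d s ld Vf sm; apply: runs_to_seq.
apply: runs_to_weaken (H d s ld Vf sm) => // s1 [s1d s1r s1m].
apply: runs_to_load; rewrite s1d s1m sm //; split=> //=; first by rewrite /upd eqxx.
by move=> r hr; rewrite /upd (live_neq _ _ _ _ sV ld (leqnn d) hr) s1r.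
Qed.

(** [G] names the partial results, all of which must fit in a word, not just the last. *)
Lemma computes_fold V f o c0 i bound body N (F G : nat -> nat) cb c :
  scope V -> i < nvars -> i \notin V ->
  computes V f m bound N cb -> N < 2 ^ w ->
  (forall j, j < N -> computes (i :: V) (upd f i j) m body (F j) c) ->
  G 0 = c0 -> (forall j, j < N -> G j.+1 = eval_op o (G j) (F j)) ->
  (forall j, j <= N -> G j < 2 ^ w) ->
  computes V f m (fold o c0 i bound body) (G N) (cb + N * (c + 5) + 6).
Proof.
move=> sV li iV Hb Nw Hbody G0 GS Gw d s ld Vf sm.
rewrite (_ : cb + _ + 6 = cb + (1 + ((N * (c + 1 + 4) + 3) + (1 + 1)))); last by lia.
have ne r d' : d <= d' -> r \in live V d -> r == d' = false.
  by move=> dd'; apply: live_neq.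
have nei r : r \in live V d -> r == i = false.
  case/orP=> [rV|hr]; last by apply/eqP; lia.
  by apply: contraNF iV => /eqP <-.
apply: runs_to_seq; apply: runs_to_weaken (Hb d s ld Vf sm) => // s1 [s1d s1r s1m].
apply: runs_to_seq; apply: runs_to_const; first by rewrite -G0 Gw.
apply: runs_to_seq.
pose I j s2 := [/\ reg s2 d.+1 = G j,
   {in live V d, reg s2 =1 reg s} & ram s2 = ram s].
have Sd : d == d.+1 = false by apply/eqP; lia.
have fin s2 : I N s2 -> runs_to w (Seq (Do (IConst d 0)) (Do (IOp OAdd d d d.+1))) s2
   (1 + 1) (fun s' => [/\ reg s' d = G N,
     {in live V d, reg s' =1 reg s} & ram s' = ram s]).
  move=> [s2d s2r s2m]; apply: runs_to_seq; apply: runs_to_const => /=; first by lia.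
  apply: runs_to_op => /=; rewrite /upd eqxx (eq_sym d.+1) Sd add0n s2d; first exact: Gw.
  by split=> //= r hr; rewrite ne // s2r.
apply: (runs_to_weaken _ _ _ _ _ _ _ (leqnn _) fin).
apply: (runs_to_for w i d d.+2 _ N _ I) => //=.
- by rewrite !inE andbT; apply/andP; split; lia.
- by lia.
- move=> j s2 s3 h23 m23 [s2d s2r s2m].
  split; rewrite ?m23 // ?h23 //; [by lia | by lia | move=> r hr].
  by rewrite h23 ?s2r // ?nei // ?ne //; lia.
- move=> j s2 jN s2i s2d [s2a s2r s2m].
  apply: runs_to_seq; apply: runs_to_weaken (Hbody j jN d.+2 s2 _ _ _) => //; first last.
  + by rewrite s2m.
  + move=> r; rewrite inE /upd; case: eqP => [->//|_ /= rV].
    by rewrite s2r ?liveV // Vf.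
  + by lia.
  move=> s3 [s3d s3r s3m].
  have s3a : reg s3 d.+1 = G j by rewrite s3r ?s2a // live_top //; lia.
  apply: runs_to_op; rewrite s3a s3d -GS //; first exact: Gw.
  have iSd : i == d.+1 = false by apply/eqP; lia.
  split=> //=; rewrite /upd ?iSd ?Sd.
  + by rewrite s3r // liveV // inE eqxx.
  + by rewrite s3r // live_top.
  split=> /=; [by rewrite eqxx | | by rewrite s3m].
  move=> r hr; rewrite ne // s3r ?s2r //; apply: live_leq hr; last by lia.
  by move=> r' rV; rewrite inE rV orbT.
- by rewrite /upd Sd.
- split=> //=; first by rewrite /upd eqxx.
  by move=> r hr; rewrite /upd ne // s1r.
Qed.

End Computes.

(** * Boolean connectives and bounded search as truncated arithmetic *)

Definition notc (e : code) : code := op OSub (const 1) e.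
Definition andc (e1 e2 : code) : code := op OMul e1 e2.
Definition itec (e e1 e2 : code) : code := op OAdd (andc e e1) (andc (notc e) e2).
Definition nzc (e : code) : code := notc (notc e).
Definition neqc (e1 e2 : code) : code := nzc (op OAdd (op OSub e1 e2) (op OSub e2 e1)).
Definition hasc (i : nat) (bound body : code) : code := nzc (fold OAdd 0 i bound body).

Section BooleanCodes.
Variables (w : nat) (m : nat -> nat) (V : seq nat) (f : nat -> nat).
Hypotheses (w_gt2 : 2 < 2 ^ w) (sV : scope V).
Local Notation comp := (computes w V f m).

Lemma computes_opE o e1 e2 v1 v2 v c1 c2 :
  comp e1 v1 c1 -> comp e2 v2 c2 -> eval_op o v1 v2 = v -> v < 2 ^ w ->
  comp (op o e1 e2) v (c1 + c2 + 1).
Proof. by move=> H1 H2 <- lev; apply: computes_op. Qed.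

Lemma computes_eq0 e v c : comp e v c -> comp (notc e) (v == 0) (c + 2).
Proof.
move=> H; rewrite (_ : c + 2 = 1 + c + 1); last by lia.
by apply: (computes_opE OSub _ _ 1 v) H _ _ => /=; [apply: computes_const | |]; lia.
Qed.

Lemma computes_not e (b : bool) c : comp e b c -> comp (notc e) (~~ b) (c + 2).
Proof. by move/computes_eq0; rewrite eqb0. Qed.

Lemma computes_nz e v c : comp e v c -> comp (nzc e) (v != 0) (c + 4).
Proof. by move/computes_eq0/computes_not; rewrite -addnA. Qed.

Lemma computes_and e1 e2 (b1 b2 : bool) c1 c2 :
  comp e1 b1 c1 -> comp e2 b2 c2 -> comp (andc e1 e2) (b1 && b2) (c1 + c2 + 1).
Proof.
by move=> H1 H2; apply: computes_opE H1 H2 _ _; rewrite /= ?mulnb //; case: (_ && _); lia.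
Qed.

Lemma computes_ite e e1 e2 (b b1 b2 : bool) c c1 c2 :
  comp e b c -> comp e1 b1 c1 -> comp e2 b2 c2 ->
  comp (itec e e1 e2) (if b then b1 else b2) (2 * c + c1 + c2 + 5).
Proof.
move=> H H1 H2; rewrite (_ : 2 * c + _ + _ + 5 = (c + c1 + 1) + ((c + 2) + c2 + 1) + 1); last by lia.
apply: computes_opE; [exact: computes_and H H1 | exact: computes_and (computes_not _ _ _ H) H2 | |].
  by case: b b1 b2 {H H1 H2} => [] [] [].
by case: (if b then _ else _); lia.
Qed.

(** One of the two truncated differences is zero, so their sum is the distance of [v1] and [v2] and
    cannot overflow. *)
Lemma computes_neq e1 e2 v1 v2 c1 c2 :
  comp e1 v1 c1 -> comp e2 v2 c2 -> v1 < 2 ^ w -> v2 < 2 ^ w ->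
  comp (neqc e1 e2) (v1 != v2) (2 * c1 + 2 * c2 + 7).
Proof.
move=> H1 H2 l1 l2.
rewrite (_ : (v1 != v2) = (v1 - v2 + (v2 - v1) != 0)); last by apply/idP/idP; lia.
rewrite (_ : _ + 7 = (c1 + c2 + 1) + (c2 + c1 + 1) + 1 + 4); last by lia.
apply: computes_nz; apply: computes_opE => //; last by lia.
- by apply: computes_opE H1 H2 _ _ => //=; lia.
- by apply: computes_opE H2 H1 _ _ => //=; lia.
Qed.

(** The loop counts the solutions, a number at most [N] and hence a word, and the count is compared
    with 0. *)
Lemma computes_has i bound body N (P : nat -> bool) cb c :
  i < nvars -> i \notin V -> comp bound N cb -> N < 2 ^ w ->
  (forall j, j < N -> computes w (i :: V) (upd f i j) m body (P j) c) ->
  comp (hasc i bound body) (has P (iota 0 N)) (cb + N * (c + 5) + 10).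
Proof.
move=> li iV Hb Nw HP.
pose G j := \sum_(0 <= u < j) (P u : nat).
have GE j : G j = count P (iota 0 j).
  by rewrite -sum1_count /G /index_iota subn0 [RHS]big_mkcond; apply: eq_bigr => u _; case: (P u).
have -> : has P (iota 0 N) = (G N != 0) by rewrite has_count GE lt0n.
rewrite (_ : _ + 10 = cb + N * (c + 5) + 6 + 4); last by lia.
apply: computes_nz; apply: (computes_fold w w_gt2 m V f OAdd 0 i _ _ _ (fun j => P j : nat) G) => //.
- by move=> j _; rewrite /G big_nat_recr.
- move=> j jN; rewrite GE; apply: leq_ltn_trans (count_size _ _) _.
  by rewrite size_iota; apply: leq_ltn_trans jN _.
Qed.

Lemma computes_exp_const e r : r \in V -> 0 < f r -> e < 2 ^ w -> f r ^ e < 2 ^ w -> 0 < e ->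
  forall i, i < nvars -> i \notin V ->
  comp (fold OMul 1 i (const e) (var r)) (f r ^ e) (7 * e + 7).
Proof.
move=> rV fr ew pw e0 i li iV.
rewrite (_ : 7 * e + 7 = 1 + e * (2 + 5) + 6); last by lia.
have le j : j <= e -> f r ^ j < 2 ^ w.
  by move=> je; apply: leq_ltn_trans pw; rewrite leq_pexp2l.
apply: (computes_fold w w_gt2 m V f OMul 1 i _ _ _ (fun=> f r) (expn (f r))) => //.
- exact: computes_const.
- move=> j je; have ri : r == i = false by apply: contraNF iV => /eqP <-.
  have -> : f r = upd f i j r by rewrite /upd ri.
  apply: computes_var => //; rewrite ?inE ?rV ?orbT //; first by rewrite /scope /= li.
  by rewrite /upd ri -(expn1 (f r)) le.
- by move=> j _; rewrite expnSr.
Qed.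

End BooleanCodes.

(** * The test applied to a mask *)

Section Search.
Variables (n x y : nat) (g : rel nat).

Definition split_by (u : nat) : bool := [&& u != x, u != y & g x u != g y u].

Definition candidate (v : nat) : bool :=
  [&& ~~ g x v, ~~ g y v & has (fun z => split_by z && g z v) (iota 0 n)].

(* The bit of a mask that encodes the candidate [v] has value [place v], the
   number of sets of candidates below [v].  Other vertices have weight 0 and
   are never selected, because [M %/ 0 = 0]. *)
Definition place (v : nat) : nat := \prod_(0 <= u < v) (1 + candidate u).

Definition weight (v : nat) : nat := candidate v * place v.

Definition selected (M v : nat) : bool := odd (M %/ weight v).

Definition dominated (M u : nat) : bool :=
  has (fun z => selected M z && g z u) (iota 0 n).

(** One scan of the neighbours of [u] serves both requirements: with a selected neighbour, [u] must
    not be selected (independence); without one, [u] must not be split (domination). *)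
Definition defect (M u : nat) : bool :=
  if dominated M u then selected M u else split_by u.

Definition good (M : nat) : bool := ~~ has (defect M) (iota 0 n).

End Search.

(** * The search as a program *)

(* Registers 0, 1, 2 hold [n], [x], [y]; the loops use the variables 3, 4, 5.
   The weight of the vertex [v] is stored at address [n * n + v]. *)
Definition adjc (a b : nat) : code :=
  load (op OAdd (op OMul (var 0) (var a)) (var b)).
Definition splitc (u : nat) : code :=
  andc (neqc (var u) (var 1))
    (andc (neqc (var u) (var 2)) (neqc (adjc 1 u) (adjc 2 u))).
Definition candidatec (v : nat) : code :=
  andc (notc (adjc 1 v)) (andc (notc (adjc 2 v))
    (hasc 5 (var 0) (andc (splitc 5) (adjc 5 v)))).
Definition weightc (v u : nat) : code :=
  op OMul (candidatec v)
    (fold OMul 1 u (var v) (op OAdd (const 1) (candidatec u))).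
Definition slotc (v : nat) : code := op OAdd (op OMul (var 0) (var 0)) (var v).
Definition selectedc (M v : nat) : code :=
  op OMod (op ODiv (var M) (load (slotc v))) (const 2).
Definition dominatedc (M u : nat) : code :=
  hasc 5 (var 0) (andc (selectedc M 5) (adjc 5 u)).
Definition goodc (M : nat) : code :=
  notc (hasc 4 (var 0) (itec (dominatedc M 4) (selectedc M 4) (splitc 4))).
(** Variable 3 counts first the factors of [n ^ e], then the masks: the bound is evaluated before
    the outer loop starts. *)
Definition searchc (e : nat) : code :=
  hasc 3 (fold OMul 1 3 (const e) (var 0)) (goodc 3).

Definition store_weights : prog :=
  for_loop 3 0 nvars (Seq (weightc 3 4 nvars.+1)
    (Seq (slotc 3 nvars.+2) (Do (IStore nvars.+2 nvars.+1)))).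

Definition relating_prog (e : nat) : prog :=
  Seq store_weights (Seq (searchc e nvars)
    (Seq (Do (IConst 0 0)) (Do (IOp OAdd 0 0 nvars)))).

(** * Correctness and running time of the program *)

Section SearchCodes.
Variables (w n x y K : nat) (g : rel nat).
Hypotheses (w_gt2 : 2 < 2 ^ w) (n_gt0 : 0 < n) (ltx : x < n) (lty : y < n).
Hypotheses (ltw : n * n + n < 2 ^ w) (ltK : K < 2 ^ w).
Hypothesis place_le : forall v, v <= n -> place n x y g v <= K.

Definition context (V : seq nat) (f : nat -> nat) : Prop :=
  [/\ scope V, {subset [:: 0; 1; 2] <= V} & [/\ f 0 = n, f 1 = x & f 2 = y]].

Lemma context_ext V f i j : 2 < i -> i < nvars -> context V f -> context (i :: V) (upd f i j).
Proof.
move=> i2 li [sV sub [f0 f1 f2]]; split.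
- by rewrite /scope /= li.
- by move=> r /sub rV; rewrite inE rV orbT.
- by rewrite /upd; case: i i2 {li} => [|[|[|]]].
Qed.

(** Addresses from [n * n] on stay unconstrained, to make room for the table of weights. *)
Definition matrix_ram (m : nat -> nat) : Prop :=
  forall u v, u < n -> v < n -> m (n * u + v) = g u v.

Section Adjacency.
Variable m : nat -> nat.
Hypothesis m_adj : matrix_ram m.

Lemma computes_lt_n V f r : context V f -> r \in V -> f r < n -> computes w V f m (var r) (f r) 2.
Proof. by move=> [sV _ _] rV lr; apply: computes_var => //; lia. Qed.

Lemma computes_n V f : context V f -> computes w V f m (var 0) n 2.
Proof.
by move=> [sV sub [f0 _ _]]; rewrite -f0; apply: computes_var; rewrite ?f0 ?sub //; lia.
Qed.

Lemma computes_adj V f a b : context V f -> a \in V -> b \in V -> f a < n -> f b < n ->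
  computes w V f m (adjc a b) (g (f a) (f b)) 9.
Proof.
move=> C aV bV la lb; have [sV sub [f0 _ _]] := C.
rewrite -m_adj // -[9]/(8 + 1); apply: computes_load => //; last by rewrite m_adj //; case: (g _ _); lia.
have lm : n * f a <= n * n by rewrite leq_mul2l (ltnW la) orbT.
rewrite -[8]/((2 + 2 + 1) + 2 + 1).
apply: (computes_opE _ _ _ _ w_gt2 sV OAdd _ _ (n * f a) (f b)) => //=.
- apply: (computes_opE _ _ _ _ w_gt2 sV OMul _ _ n (f a)) => //=.
  + exact: computes_n.
  + exact: computes_lt_n.
  + lia.
- exact: computes_lt_n.
- lia.
Qed.

Lemma computes_split V f u : context V f -> u \in V -> f u < n ->
  computes w V f m (splitc u) (split_by x y g (f u)) 75.
Proof.
move=> C uV lu; have [sV sub [f0 f1 f2]] := C.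
have [V1 V2] : 1 \in V /\ 2 \in V by split; apply: sub.
have b2 (b : bool) : b < 2 ^ w by case: b; lia.
rewrite -[75]/(15 + (15 + 43 + 1) + 1) -[15]/(2 * 2 + 2 * 2 + 7) -[43]/(2 * 9 + 2 * 9 + 7).
apply: computes_and => //.
  apply: computes_neq => //; try lia.
    exact: computes_lt_n.
  by rewrite -f1; apply: computes_lt_n; rewrite ?f1.
apply: computes_and => //.
  apply: computes_neq => //; try lia.
    exact: computes_lt_n.
  by rewrite -f2; apply: computes_lt_n; rewrite ?f2.
rewrite (_ : (g x (f u) != g y (f u)) = ((g x (f u) : nat) != g y (f u))); last by case: (g _ _) (g _ _) => [] [].
apply: computes_neq => //.
  by rewrite -f1; apply: computes_adj; rewrite ?f1.
by rewrite -f2; apply: computes_adj; rewrite ?f2.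
Qed.

Lemma computes_candidate V f v : context V f -> v \in V -> 5 \notin V -> f v < n ->
  computes w V f m (candidatec v) (candidate n x y g (f v)) (126 * n).
Proof.
move=> C vV V5 lv; have [sV sub [f0 f1 f2]] := C.
have [V1 V2] : 1 \in V /\ 2 \in V by split; apply: sub.
(* The cost is [36 + 90 * n], at most [126 * n] as [n > 0]; later constants absorb lower powers of
   [n] in the same way. *)
apply: (computes_le _ _ _ _ _ _ (11 + (11 + (2 + n * (75 + 9 + 1 + 5) + 10) + 1) + 1)); first by lia.
apply: computes_and => //.
  by rewrite -[11]/(9 + 2); apply: computes_not => //; rewrite -f1; apply: computes_adj; rewrite ?f1.
apply: computes_and => //.
  by rewrite -[11]/(9 + 2); apply: computes_not => //; rewrite -f2; apply: computes_adj; rewrite ?f2.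
apply: computes_has => //; [exact: computes_n | by lia | move=> z zn].
have C' : context (5 :: V) (upd f 5 z) by apply: context_ext.
have v5 : v == 5 = false by apply: contraNF V5 => /eqP <-.
have C'' : scope (5 :: V) by case: C'.
have fv : upd f 5 z v = f v by rewrite /upd v5.
apply: computes_and => //.
  rewrite -[X in split_by _ _ _ X]/(upd f 5 z 5).
  by apply: computes_split; rewrite ?inE.
rewrite -[X in g X _]/(upd f 5 z 5) -fv.
by apply: computes_adj; rewrite ?inE ?vV ?orbT // fv.
Qed.

Lemma computes_weight V f v u : context V f -> v \in V -> 5 \notin V -> u \notin V -> f v < n ->
  2 < u -> u < nvars -> u != 5 ->
  computes w V f m (weightc v u) (weight n x y g (f v)) (300 * n ^ 2).
Proof.
move=> C vV V5 Vu lv u2 lu u5; have [sV sub [f0 f1 f2]] := C.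
apply: (computes_le _ _ _ _ _ _ (126 * n + (2 + f v * (1 + 126 * n + 1 + 5) + 6) + 1)); first by nia.
apply: (computes_opE _ _ _ _ w_gt2 sV OMul _ _ (candidate n x y g (f v)) (place n x y g (f v))) => //.
- exact: computes_candidate.
- apply: (computes_fold w w_gt2 m V f OMul 1 u _ _ (f v) (fun j => 1 + candidate n x y g j) (place n x y g)) => //.
  + exact: computes_lt_n.
  + by lia.
  + move=> j jv; have C' : context (u :: V) (upd f u j) by apply: context_ext.
    have C'' : scope (u :: V) by case: C'.
    have fu : upd f u j u = j by rewrite /upd eqxx.
    apply: (computes_opE _ _ _ _ w_gt2 C'' OAdd _ _ 1 (candidate n x y g j)) => //.
    * by apply: computes_const => //; lia.
    * rewrite -{2}fu; apply: computes_candidate; rewrite ?inE ?eqxx ?negb_or ?(eq_sym 5) ?u5 //.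
      by rewrite fu; lia.
    * by case: (candidate _ _ _ _ _) => /=; lia.
  + by rewrite /place big_geq.
  + by move=> j _; rewrite /place big_nat_recr.
  + by move=> j jv; apply: leq_ltn_trans (place_le _ _) ltK; lia.
- rewrite /weight; case: (candidate _ _ _ _ _); rewrite ?mul1n ?mul0n; last by lia.
  by apply: leq_ltn_trans (place_le _ _) ltK; lia.
Qed.

Lemma computes_slot V f v : context V f -> v \in V -> f v < n ->
  computes w V f m (slotc v) (n * n + f v) 8.
Proof.
move=> C vV lv; have [sV sub [f0 f1 f2]] := C.
rewrite -[8]/((2 + 2 + 1) + 2 + 1).
apply: (computes_opE _ _ _ _ w_gt2 sV OAdd _ _ (n * n) (f v)) => //=; last by lia.
- apply: (computes_opE _ _ _ _ w_gt2 sV OMul _ _ n n) => //=; try exact: computes_n; lia.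
- exact: computes_lt_n.
Qed.

Hypothesis m_weight : forall v, v < n -> m (n * n + v) = weight n x y g v.

Lemma weight_le v : v < n -> weight n x y g v <= K.
Proof.
move=> vn; rewrite /weight; case: (candidate _ _ _ _ _); rewrite ?mul1n ?mul0n //.
exact/place_le/ltnW.
Qed.

Lemma computes_selected V f M v : context V f -> M \in V -> v \in V -> f v < n -> f M < 2 ^ w ->
  computes w V f m (selectedc M v) (selected n x y g (f M) (f v)) 14.
Proof.
move=> C MV vV lv lM; have [sV sub [f0 f1 f2]] := C.
rewrite -[14]/((2 + (8 + 1) + 1) + 1 + 1).
apply: (computes_opE _ _ _ _ w_gt2 sV OMod _ _ (f M %/ weight n x y g (f v)) 2) => //=.
- apply: (computes_opE _ _ _ _ w_gt2 sV ODiv _ _ (f M) (weight n x y g (f v))) => //=.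
  + exact: computes_var.
  + rewrite -m_weight //; apply: computes_load => //; first exact: computes_slot.
    by rewrite m_weight //; apply: leq_ltn_trans (weight_le _ lv) ltK.
  + exact: leq_ltn_trans (leq_div _ _) lM.
- exact: computes_const.
- by rewrite modn2.
- by case: (selected _ _ _ _ _ _); lia.
Qed.

Lemma computes_dominated V f M u : context V f -> M \in V -> u \in V -> 5 \notin V ->
  f u < n -> f M < 2 ^ w ->
  computes w V f m (dominatedc M u) (dominated n x y g (f M) (f u)) (41 * n).
Proof.
move=> C MV uV V5 lu lM; have [sV sub [f0 f1 f2]] := C.
apply: (computes_le _ _ _ _ _ _ (2 + n * (14 + 9 + 1 + 5) + 10)); first by lia.
apply: computes_has => //; [exact: computes_n | by lia | move=> z zn].
have C' : context (5 :: V) (upd f 5 z) by apply: context_ext.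
have C'' : scope (5 :: V) by case: C'.
have ne r : r \in V -> upd f 5 z r = f r.
  by move=> rV; rewrite /upd; case: eqP V5 => // <-; rewrite rV.
apply: computes_and => //.
  rewrite -(ne M) // -[X in selected _ _ _ _ _ X]/(upd f 5 z 5).
  by apply: computes_selected; rewrite ?inE ?MV ?orbT // ne.
rewrite -(ne u) // -[X in g X _]/(upd f 5 z 5).
by apply: computes_adj; rewrite ?inE ?uV ?orbT // ne.
Qed.

Lemma computes_good V f M : context V f -> M \in V -> 4 \notin V -> 5 \notin V -> f M < 2 ^ w ->
  computes w V f m (goodc M) (good n x y g (f M)) (195 * n ^ 2).
Proof.
move=> C MV V4 V5 lM; have [sV sub [f0 f1 f2]] := C.
apply: (computes_le _ _ _ _ _ _ ((2 + n * (2 * (41 * n) + 14 + 75 + 5 + 5) + 10) + 2)); first by nia.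
apply: computes_not => //; apply: computes_has => //; [exact: computes_n | by lia | move=> u un].
have C' : context (4 :: V) (upd f 4 u) by apply: context_ext.
have C'' : scope (4 :: V) by case: C'.
have fM : upd f 4 u M = f M.
  by rewrite /upd; case: eqP V4 => // <-; rewrite MV.
rewrite /defect -fM -[u in dominated _ _ _ _ _ u]/(upd f 4 u 4).
rewrite -[X in selected _ _ _ _ _ X]/(upd f 4 u 4) -[X in split_by _ _ _ X]/(upd f 4 u 4).
apply: computes_ite => //.
- by apply: computes_dominated; rewrite ?inE ?MV ?orbT ?fM.
- by apply: computes_selected; rewrite ?inE ?MV ?orbT ?fM.
- by apply: computes_split; rewrite ?inE.
Qed.

Lemma computes_search V f e : context V f -> K = n ^ e -> 0 < e -> e < 2 ^ w ->
  3 \notin V -> 4 \notin V -> 5 \notin V ->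
  computes w V f m (searchc e) (has (good n x y g) (iota 0 K)) ((7 * e + 217) * n ^ (2 + e)).
Proof.
move=> C KE e0 ew V3 V4 V5; have [sV sub [f0 f1 f2]] := C.
have K0 : 0 < n ^ e by rewrite expn_gt0 n_gt0.
apply: (computes_le _ _ _ _ _ _ (7 * e + 7 + K * (195 * n ^ 2 + 5) + 10)).
  rewrite expnD KE; move: (n ^ e) K0 => N N0.
  have : 0 < n ^ 2 by rewrite expn_gt0 n_gt0.
  move: (n ^ 2) => N2 N20; nia.
apply: computes_has => //.
  rewrite KE -f0; apply: computes_exp_const; rewrite ?f0 ?(sub 0) -?KE //; lia.
move=> M MK; have C' : context (3 :: V) (upd f 3 M) by apply: context_ext.
rewrite -[X in good _ _ _ _ X]/(upd f 3 M 3).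
by apply: computes_good; rewrite ?inE ?negb_or //=; apply: ltn_trans MK ltK.
Qed.

End Adjacency.

Lemma runs_to_store_weights s :
  reg s 0 = n -> reg s 1 = x -> reg s 2 = y -> matrix_ram (ram s) ->
  runs_to w store_weights s (316 * n ^ 3) (fun s' =>
    [/\ [/\ reg s' 0 = n, reg s' 1 = x & reg s' 2 = y], matrix_ram (ram s')
      & forall v, v < n -> ram s' (n * n + v) = weight n x y g v]).
Proof.
move=> s0 s1 s2 sm.
pose I j s' := [/\ [/\ reg s' 0 = n, reg s' 1 = x & reg s' 2 = y], matrix_ram (ram s')
      & forall v, v < j -> ram s' (n * n + v) = weight n x y g v].
apply: (runs_to_weaken _ _ _ (n * (300 * n ^ 2 + (8 + 1) + 4) + 3) _ (I n)) => //.
  by rewrite !expnS expn0; nia.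
apply: runs_to_for => //; try lia.
  by move=> j s3 s4 h hr [[? ? ?] ? ?]; rewrite /I hr; split=> //; split; rewrite h.
move=> j s3 jn s3j s3n [[h0 h1 h2] hm hw].
pose V := [:: 3; 0; 1; 2].
have C : context V (reg s3) by split=> // r; rewrite !inE => /or3P[] /eqP ->.
apply: runs_to_seq.
have := computes_weight _ hm V _ 3 4 C isT isT isT; rewrite s3j => /(_ jn isT isT isT).
move=> /(_ nvars.+1 s3 isT (fun _ _ => erefl) (fun=> erefl)).
apply: runs_to_weaken => // s4 [s4w s4r s4m].
apply: runs_to_seq.
have C4 : context V (reg s4).
  by split=> //; [case: C | split; rewrite s4r].
have s4j : reg s4 3 = j by rewrite s4r.
have hm4 : matrix_ram (ram s4) by rewrite s4m.
have := computes_slot _ V _ 3 C4 isT; rewrite s4j => /(_ (ram s4) jn).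
move=> /(_ nvars.+2 s4 isT (fun _ _ => erefl) (fun=> erefl)).
apply: runs_to_weaken => // s5 [s5a s5r s5m].
apply: runs_to_do => //=.
have s5w : reg s5 nvars.+1 = weight n x y g j by rewrite s5r.
split; [by rewrite s5r // s4r | by rewrite s5r // s4r |].
split=> /=; first by split; rewrite s5r // s4r.
(* Matrix entries lie below [n * n], out of reach of the store at [n * n + j]. *)
- move=> u v un vn; rewrite s5a s5m s4m /upd; case: eqP => [E|_]; last exact: hm.
  suff: n * u + v < n * n by lia.
  nia.
- move=> v; rewrite ltnS s5a s5m s4m s5w /upd eqn_add2l leq_eqVlt => /orP[/eqP ->|vj].
    by rewrite eqxx.
  by rewrite (ltn_eqF vj) hw.
Qed.

Lemma runs_to_relating_prog e s :
  reg s 0 = n -> reg s 1 = x -> reg s 2 = y -> matrix_ram (ram s) ->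
  K = n ^ e -> 0 < e -> e < 2 ^ w ->
  runs_to w (relating_prog e) s ((7 * e + 535) * n ^ (2 + e)) (fun s' =>
    accepts s' <-> has (good n x y g) (iota 0 K)).
Proof.
move=> s0 s1 s2 sm KE e0 ew.
have K0 : 0 < n ^ e by rewrite expn_gt0 n_gt0.
(* The constant 535 is 316 for the table, 217 for the search and 2 for copying the answer; [e > 0]
   absorbs the [n ^ 3] of the table. *)
apply: (runs_to_weaken _ _ _ (316 * n ^ 3 + ((7 * e + 217) * n ^ (2 + e) + (1 + 1))) _
  (fun s' => accepts s' <-> has (good n x y g) (iota 0 K))) => //.
  have : n ^ 3 <= n ^ (2 + e) by rewrite leq_pexp2l //; lia.
  have : 0 < n ^ (2 + e) by rewrite expn_gt0 n_gt0.
  by move: (n ^ 3) (n ^ (2 + e)) => *; nia.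
apply: runs_to_seq.
apply: runs_to_weaken (runs_to_store_weights s s0 s1 s2 sm) => // s3 [[h0 h1 h2] hm hw].
apply: runs_to_seq.
have C : context [:: 0; 1; 2] (reg s3) by split.
have := computes_search _ hm hw _ _ e C KE e0 ew isT isT isT.
move=> /(_ nvars s3 isT (fun _ _ => erefl) (fun=> erefl)).
apply: runs_to_weaken => // s4 [s4b s4r s4m].
apply: runs_to_seq; apply: runs_to_const; first by lia.
apply: runs_to_op; rewrite /= /upd /= s4b add0n; first by case: (has _ _); lia.
by rewrite /accepts /= eqb0 negbK.
Qed.

End SearchCodes.

(** * Masks as mixed-radix numbers with radices 1 and 2 *)

Section Masks.
Variables (n x y : nat) (g : rel nat).
Local Notation candidate := (candidate n x y g).
Local Notation place := (place n x y g).
Local Notation selected := (selected n x y g).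

Lemma placeS j : place j.+1 = place j * (1 + candidate j).
Proof. by rewrite /place big_nat_recr. Qed.

Lemma place_gt0 j : 0 < place j.
Proof. by rewrite prodn_gt0. Qed.

(** For a candidate [v] every later place is thus an even multiple of [place v], so later digits do
    not affect the bit of [v]. *)
Lemma dvdn_place v j : v < j -> place v * (1 + candidate v) %| place j.
Proof.
elim: j => // j IH; rewrite ltnS leq_eqVlt => /orP[/eqP ->|/IH vj]; first by rewrite -placeS.
by rewrite placeS dvdn_mulr.
Qed.

Lemma selected_candidate M v : selected M v -> candidate v.
Proof. by rewrite /selected /weight; case: (candidate v); rewrite ?mul0n ?divn0. Qed.

(** The digit of [j] is added at [place j]; the mask built so far is smaller, so the quotient by
    [place j] is this digit alone. *)
Lemma exists_mask (S : pred nat) j :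
  exists2 M, M < place j & forall v, v < j -> selected M v = candidate v && S v.
Proof.
elim: j => [|j [M ltM IH]]; first by exists 0; rewrite // place_gt0.
exists ((candidate j && S j) * place j + M).
  by rewrite placeS; move: (place_gt0 j) ltM; case: (candidate j) (S j) => [] [] /=; lia.
move=> v; rewrite ltnS leq_eqVlt => /orP[/eqP ->|vj]; rewrite /selected /weight.
  case: (candidate j); last by rewrite mul0n divn0.
  by rewrite mul1n divnMDl ?place_gt0 // (divn_small ltM) addn0; case: (S j).
rewrite -(IH v vj) /selected /weight; have := dvdn_place _ _ vj.
case: (candidate v) => /dvdnP[q ->]; last by rewrite mul0n !divn0.
(* The new digit adds an even number to the quotient by [place v]. *)
rewrite mul1n (_ : _ * _ + M = ((candidate j && S j) * q * 2) * place v + M); last by rewrite -[1 + true]/2 (mulnC (place v)) !mulnA.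
by rewrite divnMDl ?place_gt0 // oddD oddM andbF.
Qed.

Lemma place_sum v : place v = 2 ^ \sum_(0 <= u < v) candidate u.
Proof. by rewrite /place expn_sum; apply: eq_bigr => u _; case: (candidate u). Qed.

End Masks.

(** * Relating edges in terms of candidates and masks *)

Section RelatingEdges.
Variables (n : nat) (G : sgraph 'I_n) (x y : 'I_n).
Hypothesis Gxy : G x y.

(** Reading adjacency back from the input memory defines it on all numbers, as the program needs. *)
Definition matrix_adj : rel nat := fun u v => ram (input G x y) (n * u + v) != 0.

Lemma matrix_ram_input : matrix_ram n matrix_adj (ram (input G x y)).
Proof. by move=> u v _ _; rewrite /matrix_adj /=; case: [exists _, _]. Qed.

Lemma matrix_adjE (u v : 'I_n) : matrix_adj u v = G u v.
Proof.
rewrite /matrix_adj /= eqb0 negbK; apply/existsP/idP => [[u' /existsP[v' /andP[/eqP E]]]|Guv].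
  have n0 : 0 < n by apply: leq_ltn_trans (ltn_ord u).
  have /(congr1 (divn^~ n)) := E; have /(congr1 (modn^~ n)) := E.
  rewrite ![n * _]mulnC !modnMDl !divnMDl // !modn_small // !divn_small // !addn0.
  by move=> /val_inj -> /val_inj ->.
by exists u; apply/existsP; exists v; rewrite eqxx.
Qed.

Local Notation split_by := (split_by x y matrix_adj).
Local Notation candidate := (candidate n x y matrix_adj).

Lemma has_ord (P : pred nat) : has P (iota 0 n) = [exists u : 'I_n, P u].
Proof.
apply/hasP/existsP => [[u]|[u Pu]]; last by exists (val u); rewrite // mem_iota /=.
by rewrite mem_iota /= => un Pu; exists (Ordinal un).
Qed.

Lemma split_byE (u : 'I_n) : split_by u = [&& u != x, u != y & G x u != G y u].
Proof. by rewrite /split_by !matrix_adjE. Qed.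

Lemma candidateE (v : 'I_n) :
  candidate v = [&& ~~ G x v, ~~ G y v & [exists u : 'I_n, split_by u && G u v]].
Proof.
rewrite /candidate !matrix_adjE has_ord; congr [&& _, _ & _].
by apply: eq_existsb => u; rewrite matrix_adjE.
Qed.

Lemma independentP (S : {set 'I_n}) :
  reflect {in S &, forall u v, ~~ G u v} (independent G S).
Proof.
apply: (iffP forall_inP) => [H u v uS vS|H u uS]; first exact: (forall_inP (H u uS)).
by apply/forall_inP => v vS; apply: H.
Qed.

Lemma independentS (S S' : {set 'I_n}) : S \subset S' -> independent G S' -> independent G S.
Proof. by move=> /subsetP sub /independentP H; apply/independentP => u v /sub uS /sub; apply: H. Qed.

Lemma independentU1 u (S : {set 'I_n}) :
  independent G (u |: S) = independent G S && [forall v in S, ~~ G u v].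
Proof.
apply/independentP/andP => [H|[/independentP H /forall_inP Hu] a b].
  split; first by apply/independentP => a b aS bS; apply: H; rewrite in_setU1 ?aS ?bS orbT.
  by apply/forall_inP => v vS; apply: H; rewrite in_setU1 ?eqxx ?vS ?orbT.
rewrite !in_setU1 => /predU1P[->|aS] /predU1P[->|bS]; last exact: H.
- by rewrite adj_irr.
- exact: Hu.
- by rewrite adj_sym Hu.
Qed.

Lemma maximal_dominates (S : {set 'I_n}) u :
  maximal_independent G S -> u \notin S -> exists2 v, v \in S & G u v.
Proof.
move=> /maxsetP[indS maxS] uS; apply/exists_inP; apply: contraNT uS.
rewrite negb_exists_in => H; rewrite -(maxS (u |: S)) ?setU11 ?subsetUr //.
by rewrite independentU1 indS.
Qed.

(* A set witnessing that [xy] is relating may be cut down to the candidates,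
   and an independent set of candidates that dominates the split vertices
   becomes such a witness once it is made maximal among the independent sets
   avoiding the neighbours of [x] and [y]. *)
Lemma relatingP : relating G x y <->
  exists S : {set 'I_n}, [/\ {in S, forall v : 'I_n, candidate v}, independent G S
    & forall u : 'I_n, split_by u -> exists2 v, v \in S & G u v].
Proof.
have Gyx : G y x by rewrite adj_sym.
split=> [[S [indS maxx maxy]]|[S0 [candS0 indS0 domS0]]].
  have /maxsetp := maxx; have /maxsetp := maxy.
  rewrite !independentU1 => /andP[_ /forall_inP yS] /andP[_ /forall_inP xS].
  have dom (u : 'I_n) : split_by u -> exists2 v, v \in S & G u v.
    rewrite split_byE => /and3P[ux uy Guu].
    (* A split neighbour of [x] lies outside [y |: S], so it is dominated there, and not by [y],
       hence by a vertex of [S]. The other case is symmetric. *)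
    have [Gxu|Gxu] := boolP (G x u).
      have Gyu : ~~ G y u by move: Guu; rewrite Gxu; case: (G y u).
      have [|v] := maximal_dominates _ u maxy.
        by rewrite in_setU1 (negPf uy); apply: contraL Gxu => /xS.
      by rewrite in_setU1 => /predU1P[->|vS]; [rewrite adj_sym (negPf Gyu) | exists v].
    have [|v] := maximal_dominates _ u maxx.
      rewrite in_setU1 (negPf ux); apply: contraNN Guu => /yS /negPf ->.
      by rewrite (negPf Gxu).
    by rewrite in_setU1 => /predU1P[->|vS]; [rewrite adj_sym (negPf Gxu) | exists v].
  exists [set v in S | candidate v]; split.
  - by move=> v; rewrite inE => /andP[].
  - by apply: independentS indS; apply/subsetP => v; rewrite inE => /andP[].
  - move=> u uAB; have [v vS Guv] := dom u uAB; exists v => //.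
    rewrite inE vS candidateE xS // yS //=; apply/existsP; exists u; by rewrite uAB.
pose P S := independent G S && [forall v in S, ~~ (G x v || G y v)].
have PS0 : P S0.
  rewrite /P indS0; apply/forall_inP => v /candS0.
  by rewrite candidateE negb_or => /and3P[-> ->].
have [S /maxsetP[/andP[indS /forall_inP xyS] maxS] S0S] := maxset_exists PS0.
(* Here [z] is the end added to [S]. In a larger independent set [B], a vertex [u] adjacent to the
   other end would be split and so have a neighbour in [S0], which lies in [B]; any other [u] can
   join [S] within [P], so it is already there. *)
have maxz z z' : G z z' -> (forall v, G z v || G z' v = G x v || G y v) ->
    (forall u : 'I_n, u != z -> G z' u -> ~~ G z u -> split_by u) ->
    maximal_independent G (z |: S).
  move=> Gzz' zz' splitz; apply/maxsetP; split.
    rewrite independentU1 indS; apply/forall_inP => v /xyS.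
    by rewrite -zz' negb_or => /andP[].
  move=> B indB SB; apply/eqP; rewrite eqEsubset SB andbT; apply/subsetP => u uB.
  have zB : z \in B by rewrite (subsetP SB) ?setU11.
  have /independentP iB := indB.
  have SB' : S \subset B by apply: subset_trans SB; apply: subsetUr.
  rewrite in_setU1; have [//|uz /=] := eqVneq u z.
  have Gzu : ~~ G z u by apply: iB.
  have [Gz'u|Gz'u] := boolP (G z' u).
    have [v vS0 Guv] := domS0 u (splitz u uz Gz'u Gzu).
    by have := iB u v uB (subsetP SB' v (subsetP S0S v vS0)); rewrite Guv.
  rewrite -(maxS (u |: S)) ?setU11 ?subsetUr //; apply/andP; split.
    by apply: independentS indB; rewrite subUset sub1set uB.
  apply/forall_inP => v; rewrite in_setU1 => /predU1P[->|/xyS //].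
  by rewrite -zz' negb_or Gzu.
exists S; split=> //.
- apply: (maxz x y) => // u ux Gyu Gxu; rewrite split_byE ux Gyu (negPf Gxu) andbT.
  by apply: contraTneq Gyu => ->; rewrite adj_irr.
- apply: (maxz y x) => // [v|u uy Gxu Gyu]; first by rewrite orbC.
  rewrite split_byE uy Gxu (negPf Gyu) /= andbT.
  by apply: contraTneq Gxu => ->; rewrite adj_irr.
Qed.

Lemma card_candidates : #|[set v : 'I_n | candidate v]| <= 2 * max_degree G ^ 2.
Proof.
have deg (u : 'I_n) : #|neighbours G u| <= max_degree G by apply: leq_bigmax.
(* Split vertices are enlarged to all neighbours of [x] or [y]. *)
pose N := neighbours G x :|: neighbours G y.
have sub : [set v : 'I_n | candidate v] \subset \bigcup_(u in N) neighbours G u.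
  apply/subsetP => v; rewrite inE candidateE => /and3P[_ _ /existsP[u /andP[]]].
  rewrite split_byE => /and3P[_ _ su Guv]; apply/bigcupP; exists u; last by rewrite inE.
  by rewrite !inE; case: (G x u) (G y u) su => [] [].
apply: leq_trans (subset_leq_card sub) _.
apply: (@leq_trans (\sum_(u in N) #|neighbours G u|)).
  elim/big_rec2: _ => [|u A c _ leA]; first by rewrite cards0.
  by apply: leq_trans (leq_card_setU _ _) _; rewrite leq_add2l.
apply: (@leq_trans (\sum_(u in N) max_degree G)); first exact: leq_sum.
rewrite sum_nat_const -mulnn mulnA leq_mul2r; apply/orP; right.
apply: leq_trans (leq_card_setU _ _) _.
by rewrite mul2n -addnn leq_add.
Qed.

(** [K] may exceed the number of sets of candidates: a surplus mask still decodes to such a set, so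
    accepting it exhibits a genuine witness. *)
Lemma good_relating K : place n x y matrix_adj n <= K ->
  has (good n x y matrix_adj) (iota 0 K) <-> relating G x y.
Proof.
move=> leK; pose sel := selected n x y matrix_adj.
have domE M (u : 'I_n) : dominated n x y matrix_adj M u = [exists v : 'I_n, sel M v && G u v].
  by rewrite /dominated has_ord; apply: eq_existsb => v; rewrite matrix_adjE adj_sym.
have goodE M : good n x y matrix_adj M =
    [forall u : 'I_n, ~~ (if [exists v : 'I_n, sel M v && G u v] then sel M u else split_by u)].
  by rewrite /good has_ord negb_exists; apply: eq_forallb => u; rewrite /defect domE.
rewrite relatingP; split=> [/hasP[M _]|[S [candS indS domS]]].
  rewrite goodE => /forallP gM; exists [set v : 'I_n | sel M v]; split.
  - by move=> v; rewrite inE; apply: selected_candidate.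
  - apply/independentP => u v; rewrite !inE => su sv; apply: contraTN su => Guv.
    by have := gM u; case: existsP => // -[]; exists v; rewrite sv.
  - move=> u spu; have := gM u; case: existsP => [[v /andP[sv Guv]] _|_]; last by rewrite spu.
    by exists v; rewrite // inE.
have [M ltM HM] := exists_mask n x y matrix_adj (fun v => [exists u : 'I_n, (u \in S) && (val u == v)]) n.
have selE (v : 'I_n) : sel M v = (v \in S).
  rewrite /sel HM // (_ : [exists u, _] = (v \in S)); last first.
    by apply/existsP/idP => [[u /andP[uS /eqP/val_inj <-]]|vS]; last by exists v; rewrite vS eqxx.
  by case: (boolP (v \in S)) => [/candS ->|]; rewrite ?andbF.
apply/hasP; exists M; first by rewrite mem_iota add0n (leq_trans ltM leK).
rewrite goodE; apply/forallP => u; case: existsP => [[v /andP[]]|nodom].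
  rewrite !selE => vS Guv; apply: contraTN Guv => uS; exact: (independentP _ indS).
by apply/negP => /domS[v vS Guv]; apply: nodom; exists v; rewrite selE vS.
Qed.

Lemma place_le_exp : place n x y matrix_adj n <= 2 ^ (2 * max_degree G ^ 2).
Proof.
rewrite place_sum leq_exp2l // big_mkord; apply: leq_trans card_candidates.
rewrite -sum1_card [X in _ <= X]big_mkcond; apply: leq_sum => v _; rewrite inE.
by case: (candidate v).
Qed.

End RelatingEdges.

(** * From the degree bound to the number of masks *)

Lemma place_mono n x y g v : v <= n -> place n x y g v <= place n x y g n.
Proof.
by move=> vn; rewrite !place_sum leq_exp2l // (big_cat_nat (leq0n v) vn) //= leq_addr.
Qed.

(** Squared, the degree bound reads [D^2 * ln 2 <= k^2 * ln n], which is the claim under the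
    increasing function [ln]; squaring undoes the real power because [log2 n >= 0]. *)
Lemma exp_max_degree (R : realType) (k n D : nat) : 0 < n ->
  (D%:R <= k%:R * (log2 (n%:R : R)) `^ 2^-1)%R -> 2 ^ (D ^ 2) <= n ^ (k ^ 2).
Proof.
move=> n0 leD.
have n1 : (1 <= n%:R :> R)%R by rewrite ler1n.
have ln2 : (0 < ln 2 :> R)%R by apply: ln_gt0; rewrite ltr1n.
have log0 : (0 <= log2 (n%:R : R))%R by apply: divr_ge0; [exact: ln_ge0 | exact: ltW].
have : ((D%:R ^+ 2 : R) <= k%:R ^+ 2 * log2 n%:R)%R.
  apply: (@le_trans _ _ ((k%:R * (log2 (n%:R : R)) `^ 2^-1) ^+ 2)%R).
    by rewrite lerXn2r // nnegrE ?mulr_ge0 ?powR_ge0 // ler0n.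
  by rewrite exprMn -[X in (_ * X)%R]powR_mulrn ?powR_ge0 // -powRrM mulVf ?powRr1 // pnatr_eq0.
rewrite /log2 mulrA ler_pdivlMr // -!natrX ![(_ * ln _)%R]mulr_natl -!lnXn ?ltr0n //.
by rewrite -!natrX ler_ln ?posrE ?ltr0n ?expn_gt0 ?n0 // ler_nat.
Qed.

Theorem theorem10 (R : realType) (k : nat) (k_gt0 : 0 < k) :
  exists (p : prog) (a : nat) (T : nat -> nat),
    [/\ 0 < a,
        bigO T (fun n => n ^ (2 + 2 * k ^ 2))
      & forall (n : nat) (G : sgraph 'I_n) (x y : 'I_n),
          ((max_degree G)%:R <= k%:R * (log2 (n%:R : R)) `^ 2^-1)%R ->
          G x y ->
          exists (t : nat) (s : state),
            [/\ runs a p G x y t s,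
                t <= T n
              & accepts s <-> relating G x y]].
Proof.
pose e := 2 * k ^ 2.
have e0 : 0 < e by rewrite muln_gt0 expn_gt0 k_gt0.
(* Words then hold all numbers below [n.+1 ^ e.+2]: masks up to [n ^ e], addresses below [n * n + n]
   and, as [n.+1 >= 2], the constant [e]. *)
exists (relating_prog e), e.+2, (fun n => (7 * e + 535) * n ^ (2 + e)); split=> //.
  by exists (7 * e + 535), 0 => n _; apply: leqnn.
move=> n G x y degG Gxy.
have n0 : 0 < n by apply: leq_ltn_trans (ltn_ord x).
set w := e.+2 * up_log 2 n.+1.
have ltw : n.+1 ^ e.+2 <= 2 ^ w.
  by rewrite /w mulnC expnM leq_exp2r // up_logP.
have ltwe : n ^ e < 2 ^ w.
  apply: leq_trans ltw; apply: (@leq_trans (n.+1 ^ e)); first by rewrite ltn_exp2r.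
  by rewrite leq_pexp2l // leqW.
have lt2e : 2 ^ e.+2 <= 2 ^ w by apply: leq_trans ltw; rewrite leq_exp2r.
have placeK v : v <= n -> place n x y (matrix_adj n G x y) v <= n ^ e.
  move=> /place_mono le; apply: leq_trans (le _ _ _) _; apply: leq_trans (place_le_exp _ _ _ _) _.
  (* Both sides are squares, of [2 ^ (D ^ 2)] and of [n ^ (k ^ 2)], where [D] is the maximum
     degree. *)
  by rewrite mulnC expnM /e mulnC expnM leq_exp2r // (exp_max_degree R).
have := @runs_to_relating_prog w n x y (n ^ e) (matrix_adj n G x y) _ n0 (ltn_ord x) (ltn_ord y)
  _ ltwe placeK e (input G x y) erefl erefl erefl (matrix_ram_input n G x y) erefl e0.
case.
- by apply: leq_trans lt2e; rewrite !expnS; have := expn_gt0 2 e; lia.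
- apply: leq_trans ltw; apply: (@leq_trans (n.+1 ^ 2)); first by lia.
  by rewrite leq_pexp2l.
- by apply: leq_trans lt2e; apply: leq_trans (ltn_expl e (isT : 1 < 2)) _; rewrite leq_exp2l // leqW.
move=> t [s [E let_ acc]]; exists t, s; split=> //.
by rewrite acc; apply: good_relating => //; apply: placeK.
Qed.
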